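(* Every analytic minimal timelike surface of revolution in $\mathbb L^3$ is congruent to a part of one of the following surfaces: (i) a Lorentzian elliptic catenoid; (ii) a Lorentzian hyperbolic catenoid; (iii) a Lorentzian surface with spacelike profile curve; (iv) a Lorentzian parabolic catenoid.
   Context: $\mathbb L^3$ is $\mathbb R^3$ with $\langle x,y\rangle=-x_1y_1+x_2y_2+x_3y_3$. A surface is timelike if its induced metric has signature $(1,1)$ everywhere, and minimal if its mean curvature vanishes. Congruent means equal up to an isometry of $\mathbb L^3$. Analytic means real analytic. A timelike surface of revolution in $\mathbb L^3$ is (up to congruence) a surface parametrized in one of the following ways: (a) $X(t,s)=(a(t),\,b(t)\cos s,\,b(t)\sin s)$, where $(a,b,0)$ is a timelike curve and $b\neq0$; (b) $X(t,s)=(a(t)\cosh s,\,a(t)\sinh s,\,b(t))$, where $(a,0,b)$ is a timelike curve and $a\ne0$; (c) $X(t,s)=(a(s)\sinh t,\,a(s)\cosh t,\,b(s))$ with $a\neq0$, $a'^2+b'^2\neq0$; (d) $X(t,s)=\left(\frac{a(t)-b(t)}{\sqrt2}+\frac{a(t)s^2}{2\sqrt2},\ \frac{a(t)+b(t)}{\sqrt2}-\frac{a(t)s^2}{2\sqrt2},\ s\,a(t)\right)$ with $a'(t)b'(t)<0$, $a(t)\neq0$. The named surfaces, with real parameters $A>0$ and $\theta,B\in\mathbb R$, are: Lorentzian elliptic catenoid: $X(u,v)=A(u+\theta,\ \cos u\cos v,\ \cos u\sin v)$, $(u,v)\in(-\pi/2,\pi/2)\times\mathbb R$. Lorentzian hyperbolic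 catenoid: $X(u,v)=A(\sinh u\cosh v,\ \sinh u\sinh v,\ u-\theta)$, $u>0$, $v\in\mathbb R$. Lorentzian surface with spacelike profile curve: $X(u,v)=A(\cosh v\sinh u,\ \cosh v\cosh u,\ v-\theta)$, $u,v\in\mathbb R$. Lorentzian parabolic catenoid: $X(t,s)=p\,L_1+q\,L_2+r\,L_3$ with $p=A\left(\frac16t^3+\frac B2t^2+\frac{B^2}{2}t+\frac{s^2}{2}(t+B)\right)$, $q=-A(t+B)$, $r=A\,s(t+B)$, for $t<-B$, $s\in\mathbb R$, where $L_1=\left(-\frac{\sqrt2}{2},\frac{\sqrt2}{2},0\right)$, $L_2=\left(\frac{\sqrt2}{2},\frac{\sqrt2}{2},0\right)$, $L_3=(0,0,1)$.
   Formalization: The surface is additionally assumed not to lie in a plane: with b constant, forms (b) and (c) parametrize pieces of timelike planes, which are analytic, minimal and timelike but not congruent to a part of any of (i)–(iv). *)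

(* Defs.v *)
From Stdlib Require Import Reals.
From Coquelicot Require Import Coquelicot.

Open Scope R_scope.

(** ** Lorentz-Minkowski space *)

Definition L3 : Type := (R * R * R)%type.

Definition x1 (p : L3) : R := fst (fst p).
Definition x2 (p : L3) : R := snd (fst p).
Definition x3 (p : L3) : R := snd p.

Definition add3 (p q : L3) : L3 := (x1 p + x1 q, x2 p + x2 q, x3 p + x3 q).
Definition scal3 (k : R) (p : L3) : L3 := (k * x1 p, k * x2 p, k * x3 p).

Definition lorentz (p q : L3) : R := - (x1 p * x1 q) + x2 p * x2 q + x3 p * x3 q.

(* The Lorentzian cross product: lorentz (cross u v) w = det (u, v, w). *)
Definition cross (u v : L3) : L3 :=
  (- (x2 u * x3 v - x3 u * x2 v), x3 u * x1 v - x1 u * x3 v, x1 u * x2 v - x2 u * x1 v).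

Definition isometry (F : L3 -> L3) : Prop :=
  exists (M : L3 -> L3) (c : L3),
    (forall p q, M (add3 p q) = add3 (M p) (M q)) /\
    (forall k p, M (scal3 k p) = scal3 k (M p)) /\
    (forall p q, lorentz (M p) (M q) = lorentz p q) /\
    (forall p, F p = add3 (M p) c).

(** ** Parametrized surfaces

    A surface is a map [X : R -> R -> L3] considered only on a product [I * J]
    of open intervals. *)

Definition is_open_interval (I : R -> Prop) : Prop :=
  exists lo hi : Rbar, Rbar_lt lo hi /\
    forall t : R, I t <-> Rbar_lt lo t /\ Rbar_lt t hi.

Definition velocity (c : R -> L3) (t : R) : L3 :=
  (Derive (fun r => x1 (c r)) t, Derive (fun r => x2 (c r)) t, Derive (fun r => x3 (c r)) t).

Definition d1 (X : R -> R -> L3) (t s : R) : L3 := velocity (fun r => X r s) t.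
Definition d2 (X : R -> R -> L3) (t s : R) : L3 := velocity (fun r => X t r) s.

(* The double power series is summed by homogeneous parts, which is harmless
   because absolute convergence is required. *)
Definition analytic_at (f : R -> R -> R) (t0 s0 : R) : Prop :=
  exists (c : nat -> nat -> R) (eps : R), 0 < eps /\
    forall h k : R, Rabs h < eps -> Rabs k < eps ->
      ex_series (fun n => sum_f_R0 (fun i => Rabs (c i (n - i)%nat * h ^ i * k ^ (n - i))) n) /\
      is_series (fun n => sum_f_R0 (fun i => c i (n - i)%nat * h ^ i * k ^ (n - i)) n)
        (f (t0 + h) (s0 + k)).

Definition analytic_surface (I J : R -> Prop) (X : R -> R -> L3) : Prop :=
  forall t s, I t -> J s ->
    analytic_at (fun t' s' => x1 (X t' s')) t s /\
    analytic_at (fun t' s' => x2 (X t' s')) t s /\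
    analytic_at (fun t' s' => x3 (X t' s')) t s.

Definition coefE (X : R -> R -> L3) (t s : R) : R := lorentz (d1 X t s) (d1 X t s).
Definition coefF (X : R -> R -> L3) (t s : R) : R := lorentz (d1 X t s) (d2 X t s).
Definition coefG (X : R -> R -> L3) (t s : R) : R := lorentz (d2 X t s) (d2 X t s).

(* Signature (1,1) of the induced metric: the tangent plane has an orthonormal
   pair made of a unit spacelike and a unit timelike vector. *)
Definition timelike_surface (I J : R -> Prop) (X : R -> R -> L3) : Prop :=
  forall t s, I t -> J s ->
    exists a b c d : R,
      let v := add3 (scal3 a (d1 X t s)) (scal3 b (d2 X t s)) in
      let w := add3 (scal3 c (d1 X t s)) (scal3 d (d2 X t s)) in
      lorentz v v = 1 /\ lorentz w w = -1 /\ lorentz v w = 0.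

Definition unit_normal (X : R -> R -> L3) (t s : R) : L3 :=
  let w := cross (d1 X t s) (d2 X t s) in scal3 (/ sqrt (Rabs (lorentz w w))) w.

Definition coefe (X : R -> R -> L3) (t s : R) : R :=
  lorentz (d1 (d1 X) t s) (unit_normal X t s).
Definition coeff (X : R -> R -> L3) (t s : R) : R :=
  lorentz (d1 (d2 X) t s) (unit_normal X t s).
Definition coefg (X : R -> R -> L3) (t s : R) : R :=
  lorentz (d2 (d2 X) t s) (unit_normal X t s).

(* Half the trace of the second fundamental form with respect to the first. *)
Definition mean_curvature (X : R -> R -> L3) (t s : R) : R :=
  (coefe X t s * coefG X t s - 2 * coeff X t s * coefF X t s + coefg X t s * coefE X t s)
  / (2 * (coefE X t s * coefG X t s - coefF X t s ^ 2)).

Definition minimal_surface (I J : R -> Prop) (X : R -> R -> L3) : Prop :=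
  forall t s, I t -> J s -> mean_curvature X t s = 0.

(* As the Lorentz form is nondegenerate, every affine plane has such an equation. *)
Definition planar (I J : R -> Prop) (X : R -> R -> L3) : Prop :=
  exists (n : L3) (c : R), n <> (0, 0, 0) /\
    forall t s, I t -> J s -> lorentz n (X t s) = c.

Definition timelike_curve (I : R -> Prop) (c : R -> L3) : Prop :=
  forall t, I t -> lorentz (velocity c t) (velocity c t) < 0.

(** ** Timelike surfaces of revolution

    No smoothness of the profile functions [a], [b] is imposed here: it follows
    from that of the surface. In [rev_c] the profile parameter is the second one. *)

Inductive revolution_param (I J : R -> Prop) : (R -> R -> L3) -> Prop :=
| rev_a (a b : R -> R) :
    timelike_curve I (fun t => (a t, b t, 0)) ->
    (forall t, I t -> b t <> 0) ->
    revolution_param I J (fun t s => (a t, b t * cos s, b t * sin s))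
| rev_b (a b : R -> R) :
    timelike_curve I (fun t => (a t, 0, b t)) ->
    (forall t, I t -> a t <> 0) ->
    revolution_param I J (fun t s => (a t * cosh s, a t * sinh s, b t))
| rev_c (a b : R -> R) :
    (forall s, J s -> a s <> 0) ->
    (forall s, J s -> Derive a s ^ 2 + Derive b s ^ 2 <> 0) ->
    revolution_param I J (fun t s => (a s * sinh t, a s * cosh t, b s))
| rev_d (a b : R -> R) :
    (forall t, I t -> Derive a t * Derive b t < 0) ->
    (forall t, I t -> a t <> 0) ->
    revolution_param I J (fun t s =>
      ((a t - b t) / sqrt 2 + a t * s ^ 2 / (2 * sqrt 2),
       (a t + b t) / sqrt 2 - a t * s ^ 2 / (2 * sqrt 2),
       s * a t)).

Definition timelike_surface_of_revolution (I J : R -> Prop) (X : R -> R -> L3) : Prop :=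
  timelike_surface I J X /\
  exists (F : L3 -> L3) (X0 : R -> R -> L3),
    isometry F /\ revolution_param I J X0 /\
    forall t s, I t -> J s -> X t s = F (X0 t s).

(** ** The model surfaces, as subsets of [L3] *)

Definition elliptic_catenoid (A theta : R) (p : L3) : Prop :=
  exists u v : R, - (PI / 2) < u < PI / 2 /\
    p = scal3 A (u + theta, cos u * cos v, cos u * sin v).

Definition hyperbolic_catenoid (A theta : R) (p : L3) : Prop :=
  exists u v : R, 0 < u /\
    p = scal3 A (sinh u * cosh v, sinh u * sinh v, u - theta).

Definition spacelike_profile_surface (A theta : R) (p : L3) : Prop :=
  exists u v : R,
    p = scal3 A (cosh v * sinh u, cosh v * cosh u, v - theta).

Definition null1 : L3 := (- (sqrt 2 / 2), sqrt 2 / 2, 0).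
Definition null2 : L3 := (sqrt 2 / 2, sqrt 2 / 2, 0).
Definition unit3 : L3 := (0, 0, 1).

Definition parabolic_catenoid (A B : R) (p : L3) : Prop :=
  exists t s : R, t < - B /\
    p = add3 (add3
          (scal3 (A * (1 / 6 * t ^ 3 + B / 2 * t ^ 2 + B ^ 2 / 2 * t + s ^ 2 / 2 * (t + B))) null1)
          (scal3 (- A * (t + B)) null2))
          (scal3 (A * s * (t + B)) unit3).

Definition congruent_to_part_of (I J : R -> Prop) (X : R -> R -> L3) (S : L3 -> Prop) : Prop :=
  exists F : L3 -> L3, isometry F /\ forall t s, I t -> J s -> S (F (X t s)).

(* Main.v *)
Require Import Defs.
From Stdlib Require Import Reals Lra Psatz.
From Coquelicot Require Import Coquelicot.

Open Scope R_scope.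

(** Write [X = F o X0], with [F] an isometry and [X0] one of the four standard
    parametrizations with profile functions [a], [b].

    Minimality becomes an ordinary differential equation.  Up to nonvanishing factors
    the mean curvature is the expression
    [det (Xt, Xs, Xtt) <Xs, Xs> - 2 det (Xt, Xs, Xts) <Xt, Xs> + det (Xt, Xs, Xss) <Xt, Xt>],
    and a linear isometry multiplies it by its determinant, whose square is 1.  It can
    therefore be
    evaluated on [X0] ([minimal_triple_equation]), where it turns into an equation of
    second order for [(a, b)] that is invariant under reparametrization.  Analyticity
    serves to know that [a] and [b] are twice differentiable: slices of [X] along the
    parameters are sums of power series, and [a], [b] are affine combinations of the
    coordinates of [X] along a slice ([analytic_profile_C2]).

    Each profile equation has a first integral ([elliptic_profile], [hyperbolic_profile],
    [catenary_profile], [parabolic_profile]).  With [m = b' / a'] the constants are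
    - [b / sqrt (1 - m^2)] around a timelike axis,
    - [a m / sqrt (1 - m^2)] around a spacelike axis, with timelike profile,
    - [a b' / sqrt (a'^2 + b'^2)] around a spacelike axis, with spacelike profile,
    - [m / a^2] around a lightlike axis.

    In the second and third cases the constant is 0 exactly when [b] is constant, and
    then the surface lies in a plane.  Outside that case the standard parameter of the
    model is an [asin] or [arcsinh] of the slope or of the radius: by the first integral
    its derivative is a constant multiple of that of the coordinate along the axis, so that
    the two are related by an affine map, which gives [theta].  In the lightlike case
    [b' = K a^2 a'] integrates to a cubic, whose constant term is removed by a translation
    along the axis.

    A nonvanishing profile function has a constant sign on an interval, so reflections
    of [L3] reduce everything to positive profile functions and positive scale [A]. *)

(** * Linear algebra of the Lorentz form *)

Lemma L3_eq (p q : L3) : x1 p = x1 q -> x2 p = x2 q -> x3 p = x3 q -> p = q.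
Proof.
  destruct p as [[p1 p2] p3], q as [[q1 q2] q3]; unfold x1, x2, x3; simpl; congruence.
Qed.

Definition base1 : L3 := (1, 0, 0).
Definition base2 : L3 := (0, 1, 0).
Definition base3 : L3 := (0, 0, 1).

Definition triple (u v w : L3) : R := lorentz (cross u v) w.

Ltac coords := unfold triple, cross, lorentz, add3, scal3, base1, base2, base3 in *;
  unfold x1, x2, x3 in *; simpl in *.

Definition linear_isometry (M : L3 -> L3) : Prop :=
  (forall p q, M (add3 p q) = add3 (M p) (M q)) /\
  (forall k p, M (scal3 k p) = scal3 k (M p)) /\
  (forall p q, lorentz (M p) (M q) = lorentz p q).

Lemma isometry_intro (M : L3 -> L3) (c : L3) :
  linear_isometry M -> isometry (fun p => add3 (M p) c).
Proof.
  intros (Ha & Hs & Hl). exists M, c. auto.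
Qed.

Lemma linear_isometry_decomp M p : linear_isometry M ->
  M p = add3 (add3 (scal3 (x1 p) (M base1)) (scal3 (x2 p) (M base2)))
             (scal3 (x3 p) (M base3)).
Proof.
  intros (Ha & Hs & _). rewrite <- !Hs, <- !Ha. f_equal.
  apply L3_eq; coords; ring.
Qed.

Definition det_of (M : L3 -> L3) : R := triple (M base1) (M base2) (M base3).

Lemma triple_linear M u v w : linear_isometry M ->
  triple (M u) (M v) (M w) = det_of M * triple u v w.
Proof.
  intros HM. unfold det_of.
  rewrite (linear_isometry_decomp M u HM), (linear_isometry_decomp M v HM),
    (linear_isometry_decomp M w HM).
  generalize (M base1) (M base2) (M base3). intros. coords. ring.
Qed.

(** The Gram determinant of three vectors is their squared determinant times the
    determinant of the form, which is -1. *)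
Lemma triple_sqr u v w : triple u v w ^ 2 =
  - (lorentz u u * (lorentz v v * lorentz w w - lorentz v w ^ 2)
     - lorentz u v * (lorentz u v * lorentz w w - lorentz v w * lorentz u w)
     + lorentz u w * (lorentz u v * lorentz v w - lorentz v v * lorentz u w)).
Proof. coords. ring. Qed.

Lemma det_of_sqr M : linear_isometry M -> det_of M ^ 2 = 1.
Proof.
  intros (_ & _ & Hl). unfold det_of. rewrite triple_sqr, !Hl. coords. ring.
Qed.

(** Nondegeneracy of the form, in the guise of Cramer's rule: the cross products of a
    basis are, up to the factor [triple u v w], its dual basis. *)
Lemma orthogonal_to_frame u v w r : triple u v w <> 0 ->
  lorentz r u = 0 -> lorentz r v = 0 -> lorentz r w = 0 -> r = (0, 0, 0).
Proof.
  intros Hd Hu Hv Hw.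
  assert (E : scal3 (triple u v w) r =
    add3 (add3 (scal3 (lorentz r u) (cross v w)) (scal3 (lorentz r v) (cross w u)))
      (scal3 (lorentz r w) (cross u v))).
  { clear. apply L3_eq; coords; ring. }
  rewrite Hu, Hv, Hw in E.
  assert (Z : forall x, triple u v w * x = 0 -> x = 0).
  { intros x Hx. destruct (Rmult_integral _ _ Hx); tauto. }
  apply L3_eq; apply Z; [pose proof (f_equal x1 E) as K | pose proof (f_equal x2 E) as K
    | pose proof (f_equal x3 E) as K]; revert K; generalize (triple u v w); intros;
    coords; rewrite K; ring.
Qed.

(** The inverse is the Lorentz adjoint: the coordinates of [N p] are the products of [p]
    with the images of the basis vectors.  That [N] is also a right inverse, and hence an
    isometry itself, comes from the images spanning the space. *)
Lemma linear_isometry_inverse M : linear_isometry M ->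
  exists N, linear_isometry N /\ forall p, N (M p) = p.
Proof.
  intros HM. pose proof (det_of_sqr M HM) as HD.
  pose proof HM as (Ha & Hs & Hl).
  set (N := fun p => (- lorentz p (M base1), lorentz p (M base2), lorentz p (M base3)) : L3).
  assert (NM : forall p, N (M p) = p).
  { intros p. unfold N. rewrite !Hl. apply L3_eq; coords; ring. }
  assert (MN : forall p, M (N p) = p).
  { intros p.
    assert (Ho : forall q, N p = N q -> add3 p (scal3 (-1) q) = (0, 0, 0)).
    { intros q E. apply (orthogonal_to_frame (M base1) (M base2) (M base3)).
      - fold (det_of M). nra.
      - pose proof (f_equal x1 E) as K. unfold N in K. coords. lra.
      - pose proof (f_equal x2 E) as K. unfold N in K. coords. lra.
      - pose proof (f_equal x3 E) as K. unfold N in K. coords. lra. }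
    specialize (Ho (M (N p))). rewrite NM in Ho. specialize (Ho eq_refl).
    generalize dependent (M (N p)). intros q E.
    apply L3_eq; [pose proof (f_equal x1 E) as K | pose proof (f_equal x2 E) as K
    | pose proof (f_equal x3 E) as K]; coords; lra. }
  exists N. repeat split.
  - intros p q. rewrite <- (NM (add3 (N p) (N q))), Ha, !MN. reflexivity.
  - intros k p. rewrite <- (NM (scal3 k (N p))), Hs, MN. reflexivity.
  - intros p q. rewrite <- (Hl (N p)), !MN. reflexivity.
  - exact NM.
Qed.

Lemma isometry_inverse F : isometry F ->
  exists G, isometry G /\ forall p, G (F p) = p.
Proof.
  intros (M & c & Ha & Hs & Hl & HF).
  destruct (linear_isometry_inverse M) as (N & HN & NM); [repeat split; auto|].
  exists (fun p => add3 (N p) (scal3 (-1) (N c))). split.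
  - apply isometry_intro, HN.
  - intros p. destruct HN as (Na & _). rewrite HF, Na, NM.
    generalize (N c). intros. apply L3_eq; coords; ring.
Qed.

Lemma isometry_comp F G : isometry F -> isometry G -> isometry (fun p => G (F p)).
Proof.
  intros (M & c & Ma & Ms & Ml & HF) (N & d & Na & Ns & Nl & HG).
  exists (fun p => N (M p)), (add3 (N c) d). repeat split; intros.
  - rewrite Ma, Na; reflexivity.
  - rewrite Ms, Ns; reflexivity.
  - rewrite Nl, Ml; reflexivity.
  - rewrite HG, HF, Na. generalize (N (M p)) (N c). intros. apply L3_eq; coords; ring.
Qed.

(** The only isometries needed to bring a profile into normal position: independent signs
    on the plane of the first two coordinates and on the third axis, and a translation. *)
Lemma isometry_flip (e f : R) (c : L3) : e ^ 2 = 1 -> f ^ 2 = 1 ->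
  isometry (fun p => add3 (e * x1 p, e * x2 p, f * x3 p) c).
Proof.
  intros He Hf. apply (isometry_intro (fun p => (e * x1 p, e * x2 p, f * x3 p))).
  repeat split; intros.
  - apply L3_eq; coords; ring.
  - apply L3_eq; coords; ring.
  - replace (e ^ 2) with (e * e) in He by ring. replace (f ^ 2) with (f * f) in Hf by ring.
    coords. transitivity (- (e * e * (fst (fst p) * fst (fst q))) +
      e * e * (snd (fst p) * snd (fst q)) + f * f * (snd p * snd q)); [ring|].
    rewrite He, Hf. ring.
Qed.

(** * Functions on open intervals *)

Lemma open_interval_locally I t : is_open_interval I -> I t -> locally t I.
Proof.
  intros (lo & hi & Hlt & HI) Ht. apply HI in Ht as [H1 H2].
  apply filter_imp with (fun x : R => Rbar_lt lo x /\ Rbar_lt x hi); [intros; now apply HI|].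
  apply filter_and; [now apply open_Rbar_gt | now apply open_Rbar_lt].
Qed.

Lemma open_interval_inhabited I : is_open_interval I -> exists t, I t.
Proof.
  intros (lo & hi & Hlt & HI).
  destruct lo as [l| |], hi as [h| |]; simpl in Hlt; try tauto;
  [exists ((l + h) / 2) | exists (l + 1) | exists (h - 1) | exists 0];
  apply HI; simpl; lra.
Qed.

Lemma open_interval_convex I a b t : is_open_interval I -> I a -> I b -> a <= t <= b -> I t.
Proof.
  intros (lo & hi & Hlt & HI) Ha Hb Ht. apply HI in Ha, Hb. apply HI.
  destruct lo, hi; simpl in *; lra.
Qed.

Lemma constant_on_interval (I : R -> Prop) (f : R -> R) : is_open_interval I ->
  (forall t, I t -> is_derive f t 0) -> exists k : R, forall t, I t -> f t = k.
Proof.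
  intros HI Hf. destruct (open_interval_inhabited I HI) as [t0 H0]. exists (f t0).
  intros t Ht. destruct (Rtotal_order t t0) as [L | [-> | L]]; [| reflexivity |].
  - apply (eq_is_derive f); [|exact L]. intros x Hx. apply Hf.
    now apply (open_interval_convex I t t0).
  - symmetry. apply (eq_is_derive f); [|exact L]. intros x Hx. apply Hf.
    now apply (open_interval_convex I t0 t).
Qed.

Lemma is_derive_eq (f : R -> R) (t l l' : R) : is_derive f t l -> l = l' -> is_derive f t l'.
Proof. now intros H <-. Qed.

Lemma is_derive_ext_R (f g : R -> R) (t l : R) :
  (forall r, f r = g r) -> is_derive f t l -> is_derive g t l.
Proof. intros E. now apply is_derive_ext. Qed.

(** [auto_derive] leaves [Derive] applied to the unknown profile functions; their values
    are found among the hypotheses. *)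
Ltac derive_known :=
  repeat match goal with |- context [Derive ?g ?t] =>
    erewrite (is_derive_unique g t) by eassumption end.
Ltac known_derivatives := repeat split; try (eexists; eassumption).

Lemma is_derive_affine (f g h : R -> R) (t f1 g1 h1 k0 k1 k2 k3 : R) :
  is_derive f t f1 -> is_derive g t g1 -> is_derive h t h1 ->
  is_derive (fun r => k1 * f r + k2 * g r + k3 * h r + k0) t (k1 * f1 + k2 * g1 + k3 * h1).
Proof.
  intros Hf Hg Hh. auto_derive; [known_derivatives | derive_known; ring].
Qed.

(** [f / |f|], written with a square root to be differentiable, has derivative 0. *)
Lemma constant_sign (I : R -> Prop) (f f1 : R -> R) : is_open_interval I ->
  (forall t, I t -> is_derive f t (f1 t)) -> (forall t, I t -> f t <> 0) ->
  exists e, e ^ 2 = 1 /\ forall t, I t -> 0 < e * f t.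
Proof.
  intros HI Hf Hn.
  destruct (constant_on_interval I (fun t => f t / sqrt (f t * f t)) HI) as [k Hk].
  { intros t Ht. pose proof (Hf t Ht) as D. pose proof (Hn t Ht) as N.
    assert (P : 0 < f t * f t) by nra.
    pose proof (sqrt_lt_R0 _ P) as Q. pose proof (sqrt_sqrt _ (Rlt_le _ _ P)) as S.
    auto_derive.
    - known_derivatives; lra.
    - derive_known. set (q := sqrt (f t * f t)) in *.
      apply (Rmult_eq_reg_r (2 * (q * (q * q)))); [|nra].
      field_simplify; [|nra]. simpl.
      replace (q * (q * 1)) with (f t * f t) by lra. ring. }
  destruct (Rle_dec k 0) as [L | L]; [exists (-1) | exists 1]; (split; [ring|]); intros t Ht;
    specialize (Hk t Ht); specialize (Hn t Ht); cbv beta in Hk;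
    assert (P : 0 < f t * f t) by nra; pose proof (sqrt_lt_R0 _ P) as Q;
    assert (E : f t = k * sqrt (f t * f t)) by (rewrite <- Hk; field; lra); nra.
Qed.

(** * Minimality as an equation on second-order jets *)

Definition is_velocity (c : R -> L3) (t : R) (v : L3) : Prop :=
  is_derive (fun r => x1 (c r)) t (x1 v) /\
  is_derive (fun r => x2 (c r)) t (x2 v) /\
  is_derive (fun r => x3 (c r)) t (x3 v).

Lemma velocity_unique c t v : is_velocity c t v -> velocity c t = v.
Proof.
  intros (H1 & H2 & H3). unfold velocity.
  apply L3_eq; unfold x1, x2, x3; simpl; now apply is_derive_unique.
Qed.

Lemma is_velocity_ext_loc c d t v :
  locally t (fun r => c r = d r) -> is_velocity c t v -> is_velocity d t v.
Proof.
  intros E (H1 & H2 & H3).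
  repeat split; (eapply is_derive_ext_loc; [|eassumption]);
    (apply filter_imp with (2 := E); intros r ->; reflexivity).
Qed.

Lemma is_velocity_affine M c0 c t v : linear_isometry M ->
  is_velocity c t v -> is_velocity (fun r => add3 (M (c r)) c0) t (M v).
Proof.
  intros HM (H1 & H2 & H3).
  rewrite (linear_isometry_decomp M v HM).
  assert (K : forall pr : L3 -> R,
    (forall p q, pr (add3 p q) = pr p + pr q) -> (forall k p, pr (scal3 k p) = k * pr p) ->
    is_derive (fun r => pr (add3 (M (c r)) c0)) t
      (pr (add3 (add3 (scal3 (x1 v) (M base1)) (scal3 (x2 v) (M base2)))
        (scal3 (x3 v) (M base3))))).
  { intros pr Pa Ps.
    apply is_derive_ext_R with (fun r => pr (M base1) * x1 (c r) + pr (M base2) * x2 (c r)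
      + pr (M base3) * x3 (c r) + pr c0).
    - intros r. rewrite (linear_isometry_decomp M (c r) HM), !Pa, !Ps. ring.
    - rewrite !Pa, !Ps. eapply is_derive_eq; [apply is_derive_affine; eassumption | ring]. }
  repeat split; apply K; reflexivity.
Qed.

Lemma is_velocity_linear M c t v : linear_isometry M ->
  is_velocity c t v -> is_velocity (fun r => M (c r)) t (M v).
Proof.
  intros HM H. apply is_velocity_ext_loc with (fun r => add3 (M (c r)) (0, 0, 0)).
  - apply filter_forall. intros r. generalize (M (c r)). intros q. apply L3_eq; coords; ring.
  - now apply is_velocity_affine.
Qed.

(** The Gram determinant of a pair in the plane of [u] and [v] is that of [u], [v] times
    the square of the change-of-basis determinant; for the orthonormal pair it is -1. *)
Lemma gram_nonzero u v :
  (exists a b c d : R,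
      let p := add3 (scal3 a u) (scal3 b v) in
      let q := add3 (scal3 c u) (scal3 d v) in
      lorentz p p = 1 /\ lorentz q q = -1 /\ lorentz p q = 0) ->
  lorentz u u * lorentz v v - lorentz u v ^ 2 <> 0.
Proof.
  intros (a & b & c & d & H) Z. cbv zeta in H. destruct H as (H1 & H2 & H3).
  assert (E : lorentz (add3 (scal3 a u) (scal3 b v)) (add3 (scal3 a u) (scal3 b v)) *
    lorentz (add3 (scal3 c u) (scal3 d v)) (add3 (scal3 c u) (scal3 d v)) -
    lorentz (add3 (scal3 a u) (scal3 b v)) (add3 (scal3 c u) (scal3 d v)) ^ 2 =
    (a * d - b * c) ^ 2 * (lorentz u u * lorentz v v - lorentz u v ^ 2)).
  { clear. coords. ring. }
  rewrite H1, H2, H3, Z in E. lra.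
Qed.

Lemma cross_lorentz u v :
  lorentz (cross u v) (cross u v) = - (lorentz u u * lorentz v v - lorentz u v ^ 2).
Proof. coords. ring. Qed.

Lemma lorentz_scal_r u k v : lorentz u (scal3 k v) = k * lorentz u v.
Proof. coords. ring. Qed.

Lemma lorentz_sym u v : lorentz u v = lorentz v u.
Proof. coords. ring. Qed.

(** The jets [P1], ..., [P22] of [X0] are explicit data, so that in each type of
    revolution they can be given by closed formulas in the profile functions.  The
    normalization of the normal vector and the determinant of [M] enter the mean curvature
    as common nonzero factors. *)
Lemma minimal_triple_equation (I J : R -> Prop) X F X0 P1 P2 P11 P12 P22 :
  is_open_interval I -> is_open_interval J ->
  timelike_surface I J X -> minimal_surface I J X ->
  isometry F -> (forall t s, I t -> J s -> X t s = F (X0 t s)) ->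
  (forall t s, I t -> J s ->
     is_velocity (fun r => X0 r s) t (P1 t s) /\
     is_velocity (fun r => X0 t r) s (P2 t s) /\
     is_velocity (fun r => P1 r s) t (P11 t s) /\
     is_velocity (fun r => P2 r s) t (P12 t s) /\
     is_velocity (fun r => P2 t r) s (P22 t s)) ->
  forall t s, I t -> J s ->
    triple (P1 t s) (P2 t s) (P11 t s) * lorentz (P2 t s) (P2 t s)
    - 2 * triple (P1 t s) (P2 t s) (P12 t s) * lorentz (P1 t s) (P2 t s)
    + triple (P1 t s) (P2 t s) (P22 t s) * lorentz (P1 t s) (P1 t s) = 0.
Proof.
  intros HI HJ Htl Hmin (M & c0 & Ma & Ms & Ml & HF) HX HP.
  assert (HM : linear_isometry M) by (repeat split; auto).
  assert (E1 : forall t s, I t -> J s -> Defs.d1 X t s = M (P1 t s)).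
  { intros t s Ht Hs. apply velocity_unique.
    apply is_velocity_ext_loc with (fun r => add3 (M (X0 r s)) c0).
    - apply filter_imp with (2 := open_interval_locally I t HI Ht).
      intros r Hr. now rewrite HX, HF.
    - apply is_velocity_affine; [exact HM | now apply HP]. }
  assert (E2 : forall t s, I t -> J s -> Defs.d2 X t s = M (P2 t s)).
  { intros t s Ht Hs. apply velocity_unique.
    apply is_velocity_ext_loc with (fun r => add3 (M (X0 t r)) c0).
    - apply filter_imp with (2 := open_interval_locally J s HJ Hs).
      intros r Hr. now rewrite HX, HF.
    - apply is_velocity_affine; [exact HM | now apply HP]. }
  intros t s Ht Hs.
  destruct (HP t s Ht Hs) as (_ & _ & V11 & V12 & V22).
  assert (E11 : Defs.d1 (Defs.d1 X) t s = M (P11 t s)).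
  { apply velocity_unique, is_velocity_ext_loc with (fun r => M (P1 r s)).
    - apply filter_imp with (2 := open_interval_locally I t HI Ht).
      intros r Hr. now rewrite E1.
    - now apply is_velocity_linear. }
  assert (E12 : Defs.d1 (Defs.d2 X) t s = M (P12 t s)).
  { apply velocity_unique, is_velocity_ext_loc with (fun r => M (P2 r s)).
    - apply filter_imp with (2 := open_interval_locally I t HI Ht).
      intros r Hr. now rewrite E2.
    - now apply is_velocity_linear. }
  assert (E22 : Defs.d2 (Defs.d2 X) t s = M (P22 t s)).
  { apply velocity_unique, is_velocity_ext_loc with (fun r => M (P2 t r)).
    - apply filter_imp with (2 := open_interval_locally J s HJ Hs).
      intros r Hr. now rewrite E2.
    - now apply is_velocity_linear. }
  pose proof (gram_nonzero _ _ (Htl t s Ht Hs)) as HG.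
  pose proof (Hmin t s Ht Hs) as H. unfold mean_curvature, coefe, coeff, coefg,
    unit_normal, coefE, coefF, coefG in H.
  rewrite E11, E12, E22 in H. rewrite E1, E2 in H, HG by assumption.
  cbv zeta in H. rewrite !lorentz_scal_r, cross_lorentz in H.
  rewrite !(lorentz_sym (M (_ t s)) (cross _ _)) in H.
  fold (triple (M (P1 t s)) (M (P2 t s)) (M (P11 t s))) in H.
  fold (triple (M (P1 t s)) (M (P2 t s)) (M (P12 t s))) in H.
  fold (triple (M (P1 t s)) (M (P2 t s)) (M (P22 t s))) in H.
  rewrite !(triple_linear M _ _ _ HM), !Ml in H. rewrite !Ml in HG.
  pose proof (det_of_sqr M HM) as HD.
  set (g := lorentz (P1 t s) (P1 t s) * lorentz (P2 t s) (P2 t s) -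
    lorentz (P1 t s) (P2 t s) ^ 2) in *.
  assert (HK : / sqrt (Rabs (- g)) <> 0).
  { apply Rinv_neq_0_compat, Rgt_not_eq, sqrt_lt_R0, Rabs_pos_lt. lra. }
  set (k := / sqrt (Rabs (- g))) in *.
  assert (HDn : det_of M <> 0) by nra.
  set (D := det_of M) in *.
  match goal with |- ?L = 0 => set (l := L);
    assert (E : k * D * l = 0) end.
  { apply (Rmult_eq_reg_r (/ (2 * g))); [|apply Rinv_neq_0_compat; lra].
    rewrite Rmult_0_l. rewrite <- H. unfold l, Rdiv. ring. }
  destruct (Rmult_integral _ _ E) as [E' | E']; [|exact E'].
  destruct (Rmult_integral _ _ E'); tauto.
Qed.

(** * Regularity of the profile functions *)

Definition C2_on (I : R -> Prop) (f : R -> R) : Prop :=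
  exists f1 f2 : R -> R, forall t, I t -> is_derive f t (f1 t) /\ is_derive f1 t (f2 t).

Lemma C2_on_ext I f g : is_open_interval I ->
  (forall t, I t -> f t = g t) -> C2_on I f -> C2_on I g.
Proof.
  intros HI E (f1 & f2 & H). exists f1, f2. intros t Ht. split; [|now apply H].
  apply is_derive_ext_loc with f; [|now apply H].
  apply filter_imp with (2 := open_interval_locally I t HI Ht). exact E.
Qed.

Lemma C2_on_affine I f g h (k0 k1 k2 k3 : R) : C2_on I f -> C2_on I g -> C2_on I h ->
  C2_on I (fun t => k1 * f t + k2 * g t + k3 * h t + k0).
Proof.
  intros (f1 & f2 & Hf) (g1 & g2 & Hg) (h1 & h2 & Hh).
  exists (fun t => k1 * f1 t + k2 * g1 t + k3 * h1 t),
    (fun t => k1 * f2 t + k2 * g2 t + k3 * h2 t).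
  intros t Ht. destruct (Hf t Ht), (Hg t Ht), (Hh t Ht). split.
  - now apply is_derive_affine.
  - apply is_derive_ext_R with (fun r => k1 * f1 r + k2 * g1 r + k3 * h1 r + 0);
      [intros; ring | now apply is_derive_affine].
Qed.

(** The sum is represented by the same coefficients on a neighbourhood of [t0], not just
    at [t0]: this is what allows [Derive f] to be differentiated again. *)
Lemma power_series_twice_derivable (f : R -> R) (c : nat -> R) (t0 eps : R) : 0 < eps ->
  (forall h, Rabs h < eps -> is_series (fun n => c n * h ^ n) (f (t0 + h))) ->
  ex_derive f t0 /\ ex_derive (Derive f) t0.
Proof.
  intros He Hs.
  assert (HR : forall h, Rabs h < eps -> Rbar_lt (Rabs h) (CV_radius c)).
  { intros h Hh. set (h' := (Rabs h + eps) / 2).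
    pose proof (Rabs_pos h). assert (Hp : Rabs h' = h') by (apply Rabs_right; unfold h'; lra).
    apply Rbar_lt_le_trans with (Finite h'); [simpl; unfold h'; lra|].
    apply Rbar_not_lt_le. intros L.
    apply (CV_disk_outside c h'); [now rewrite Hp|].
    apply ex_series_lim_0. eexists. apply Hs. rewrite Hp. unfold h'. lra. }
  assert (HE : forall t, Rabs (t - t0) < eps -> PSeries c (t - t0) = f t).
  { intros t Ht. replace (f t) with (f (t0 + (t - t0))) by (f_equal; ring).
    apply is_pseries_unique, is_pseries_R, Hs, Ht. }
  assert (HB : forall t, Rabs (t - t0) < eps -> locally t (fun r => Rabs (r - t0) < eps)).
  { intros t Ht. assert (Hp : 0 < eps - Rabs (t - t0)) by lra.
    exists (mkposreal _ Hp). intros r Hr. change (Rabs (r - t) < eps - Rabs (t - t0)) in Hr.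
    pose proof (Rabs_triang (r - t) (t - t0)).
    replace (r - t + (t - t0)) with (r - t0) in H by ring. lra. }
  assert (HC : forall d, (forall h, Rabs h < eps -> Rbar_lt (Rabs h) (CV_radius d)) ->
    forall t, Rabs (t - t0) < eps ->
    is_derive (fun r => PSeries d (r - t0)) t (PSeries (PS_derive d) (t - t0))).
  { intros d Hd t Ht.
    apply is_derive_eq with (scal 1 (PSeries (PS_derive d) (t - t0))).
    - apply (is_derive_comp (PSeries d) (fun r => r - t0)).
      + now apply is_derive_PSeries, Hd.
      + auto_derive; [trivial | ring].
    - unfold scal; simpl; unfold mult; simpl; ring. }
  assert (H1 : forall t, Rabs (t - t0) < eps -> is_derive f t (PSeries (PS_derive c) (t - t0))).
  { intros t Ht. apply is_derive_ext_loc with (fun r => PSeries c (r - t0)).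
    - apply filter_imp with (2 := HB t Ht). exact HE.
    - now apply HC. }
  assert (H0 : Rabs (t0 - t0) < eps) by (rewrite Rminus_diag, Rabs_R0; exact He).
  split; [eexists; now apply H1|].
  eexists. apply is_derive_ext_loc with (fun r => PSeries (PS_derive c) (r - t0)).
  - apply filter_imp with (2 := HB t0 H0). intros r Hr. symmetry.
    now apply is_derive_unique, H1.
  - apply HC; [|exact H0]. intros h Hh. rewrite CV_radius_derive. now apply HR.
Qed.

Lemma C2_on_intro I f : (forall t, I t -> ex_derive f t /\ ex_derive (Derive f) t) -> C2_on I f.
Proof.
  intros H. exists (Derive f), (Derive (Derive f)). intros t Ht.
  destruct (H t Ht). split; now apply Derive_correct.
Qed.

(** On a coordinate line through the centre, each homogeneous part of a double power
    series is reduced to a single monomial. *)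
Lemma homogeneous_part_left (c : nat -> nat -> R) (h : R) (n : nat) :
  sum_f_R0 (fun i => c i (n - i)%nat * h ^ i * 0 ^ (n - i)) n = c n 0%nat * h ^ n.
Proof.
  destruct n as [|n]; [simpl; ring|]. rewrite tech5, PeanoNat.Nat.sub_diag.
  rewrite sum_eq_R0; [simpl; ring|]. intros i Hi.
  rewrite (pow_ne_zero (S n - i)); [ring | lia].
Qed.

Lemma homogeneous_part_right (c : nat -> nat -> R) (k : R) (n : nat) :
  sum_f_R0 (fun i => c i (n - i)%nat * 0 ^ i * k ^ (n - i)) n = c 0%nat n * k ^ n.
Proof.
  destruct n as [|n]; [simpl; ring|]. rewrite decomp_sum by lia.
  rewrite sum_eq_R0; [simpl; ring|]. intros i Hi. simpl. ring.
Qed.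

Lemma analytic_at_slices f t s : analytic_at f t s ->
  (ex_derive (fun r => f r s) t /\ ex_derive (Derive (fun r => f r s)) t) /\
  (ex_derive (fun r => f t r) s /\ ex_derive (Derive (fun r => f t r)) s).
Proof.
  intros (c & eps & He & H).
  assert (H0 : Rabs 0 < eps) by (now rewrite Rabs_R0). split.
  - apply (power_series_twice_derivable _ (fun n => c n 0%nat) _ eps He). intros h Hh.
    destruct (H h 0 Hh H0) as [_ S]. rewrite Rplus_0_r in S.
    eapply is_series_ext; [|exact S]. intros n. apply homogeneous_part_left.
  - apply (power_series_twice_derivable _ (fun n => c 0%nat n) _ eps He). intros h Hh.
    destruct (H 0 h H0 Hh) as [_ S]. rewrite Rplus_0_r in S.
    eapply is_series_ext; [|exact S]. intros n. apply homogeneous_part_right.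
Qed.

(** Coordinates of an isometry are affine functions, so an affine combination of the
    coordinates of [G (c t)] is one of the coordinates of [c t]. *)
Lemma isometry_C2 I G (c : R -> L3) : isometry G ->
  C2_on I (fun t => x1 (c t)) -> C2_on I (fun t => x2 (c t)) -> C2_on I (fun t => x3 (c t)) ->
  forall k0 k1 k2 k3,
  C2_on I (fun t => k1 * x1 (G (c t)) + k2 * x2 (G (c t)) + k3 * x3 (G (c t)) + k0).
Proof.
  intros (M & c0 & Ma & Ms & Ml & HG) H1 H2 H3 k0 k1 k2 k3.
  assert (HM : linear_isometry M) by (repeat split; auto).
  set (L := fun p => k1 * x1 p + k2 * x2 p + k3 * x3 p).
  destruct (C2_on_affine I _ _ _ (L c0 + k0) (L (M base1)) (L (M base2)) (L (M base3)) H1 H2 H3)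
    as (f1 & f2 & Hf).
  exists f1, f2. intros t Ht. split; [|now apply Hf].
  eapply is_derive_ext_R; [|now apply Hf]. intros r. cbv beta.
  rewrite HG, (linear_isometry_decomp M (c r) HM). unfold L.
  generalize (M base1) (M base2) (M base3). intros. coords. ring.
Qed.

(** The functions recovered from [X0] here are the profile functions [a] and [b]: at a
    fixed value of the rotation parameter they are affine combinations of the coordinates. *)
Lemma analytic_profile_C2 I J X X0 F : analytic_surface I J X -> isometry F ->
  is_open_interval I -> is_open_interval J ->
  (forall t s, I t -> J s -> X t s = F (X0 t s)) ->
  forall k0 k1 k2 k3,
  (forall s, J s -> C2_on I (fun t => k1 * x1 (X0 t s) + k2 * x2 (X0 t s) + k3 * x3 (X0 t s) + k0)) /\
  (forall t, I t -> C2_on J (fun s => k1 * x1 (X0 t s) + k2 * x2 (X0 t s) + k3 * x3 (X0 t s) + k0)).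
Proof.
  intros Han HF HI HJ HX k0 k1 k2 k3.
  destruct (isometry_inverse F HF) as (G & HG & GF). split.
  - intros s Hs. eapply C2_on_ext; [exact HI | |
      apply (isometry_C2 I G (fun t => X t s) HG) with (k0 := k0) (k1 := k1) (k2 := k2) (k3 := k3)].
    + intros t Ht. cbv beta. now rewrite HX, GF.
    + apply C2_on_intro. intros t Ht. exact (proj1 (analytic_at_slices (fun t' s' => x1 (X t' s')) t s (proj1 (Han t s Ht Hs)))).
    + apply C2_on_intro. intros t Ht. exact (proj1 (analytic_at_slices (fun t' s' => x2 (X t' s')) t s (proj1 (proj2 (Han t s Ht Hs))))).
    + apply C2_on_intro. intros t Ht. exact (proj1 (analytic_at_slices (fun t' s' => x3 (X t' s')) t s (proj2 (proj2 (Han t s Ht Hs))))).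
  - intros t Ht. eapply C2_on_ext; [exact HJ | |
      apply (isometry_C2 J G (fun s => X t s) HG) with (k0 := k0) (k1 := k1) (k2 := k2) (k3 := k3)].
    + intros s Hs. cbv beta. now rewrite HX, GF.
    + apply C2_on_intro. intros s Hs. exact (proj2 (analytic_at_slices (fun t' s' => x1 (X t' s')) t s (proj1 (Han t s Ht Hs)))).
    + apply C2_on_intro. intros s Hs. exact (proj2 (analytic_at_slices (fun t' s' => x2 (X t' s')) t s (proj1 (proj2 (Han t s Ht Hs))))).
    + apply C2_on_intro. intros s Hs. exact (proj2 (analytic_at_slices (fun t' s' => x3 (X t' s')) t s (proj2 (proj2 (Han t s Ht Hs))))).
Qed.

(** * First integrals of the profile equations *)

Lemma is_derive_asin x : -1 < x < 1 -> is_derive asin x (/ sqrt (1 - x * x)).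
Proof.
  intros Hx. apply is_derive_eq with (derive_pt asin x (derivable_pt_asin x Hx)).
  - apply is_derive_Reals. exact (proj2_sig (derivable_pt_asin x Hx)).
  - rewrite derive_pt_asin. unfold Rsqr. field.
    apply Rgt_not_eq, sqrt_lt_R0. nra.
Qed.

Lemma is_derive_arcsinh x : is_derive arcsinh x (/ sqrt (x ^ 2 + 1)).
Proof. apply is_derive_Reals, derivable_pt_lim_arcsinh. Qed.

Lemma is_derive_comp_R (f g : R -> R) (t df dg : R) :
  is_derive f (g t) df -> is_derive g t dg -> is_derive (fun r => f (g r)) t (dg * df).
Proof. intros Hf Hg. exact (is_derive_comp f g t df dg Hf Hg). Qed.

Lemma cosh_pos x : 0 < cosh x.
Proof. unfold cosh. pose proof (exp_pos x). pose proof (exp_pos (- x)). lra. Qed.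

Lemma cosh_sinh_identity x : cosh x * cosh x - sinh x * sinh x = 1.
Proof.
  unfold cosh, sinh. transitivity (exp x * exp (- x)); [field|].
  rewrite <- exp_plus, Rplus_opp_r. apply exp_0.
Qed.

Lemma cosh_arcsinh x : cosh (arcsinh x) = sqrt (x ^ 2 + 1).
Proof.
  rewrite <- (sqrt_pow2 (cosh (arcsinh x))) by (left; apply cosh_pos).
  f_equal. pose proof (cosh_sinh_identity (arcsinh x)) as E.
  rewrite sinh_arcsinh in E. simpl. lra.
Qed.

Lemma arcsinh_pos x : 0 < x -> 0 < arcsinh x.
Proof. rewrite <- arcsinh_0 at 2. apply arcsinh_lt. Qed.

(** The curve [(a, b)], with its first and second derivatives. *)
Section Profile.
Variables (I : R -> Prop) (a a1 a2 b b1 b2 : R -> R).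
Hypothesis HI : is_open_interval I.
Hypothesis Ha : forall t, I t -> is_derive a t (a1 t) /\ is_derive a1 t (a2 t).
Hypothesis Hb : forall t, I t -> is_derive b t (b1 t) /\ is_derive b1 t (b2 t).

Lemma is_derive_slope t : I t -> a1 t <> 0 ->
  is_derive (fun r => b1 r / a1 r) t ((a1 t * b2 t - a2 t * b1 t) / a1 t ^ 2).
Proof.
  intros Ht Hn. destruct (Ha t Ht) as [_ A2], (Hb t Ht) as [_ B2].
  eapply is_derive_eq; [apply is_derive_div; eassumption | now field].
Qed.

(** How the model parameter and the remaining coordinate are compared: their derivatives
    are proportional. *)
Lemma affine_relation (f f1 g : R -> R) (k : R) :
  (forall t, I t -> is_derive f t (f1 t) /\ is_derive g t (k * f1 t)) ->
  exists c, forall t, I t -> g t = k * f t + c.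
Proof.
  intros H. destruct (constant_on_interval I (fun t => 0 * g t + 1 * g t + - k * f t + 0) HI)
    as [c Hc].
  - intros t Ht. destruct (H t Ht) as [F G].
    eapply is_derive_eq; [apply is_derive_affine; eassumption | simpl; ring].
  - exists c. intros t Ht. rewrite <- (Hc t Ht). ring.
Qed.

Lemma slope_bound t : b1 t ^ 2 < a1 t ^ 2 -> a1 t <> 0 /\ -1 < b1 t / a1 t < 1.
Proof.
  intros H. assert (Hn : a1 t <> 0) by nra. split; [exact Hn|].
  set (m := b1 t / a1 t). assert (E : b1 t = m * a1 t) by (unfold m; now field).
  rewrite E in H. assert (0 < a1 t * a1 t) by nra.
  assert (m * m < 1) by (apply (Rmult_lt_reg_r (a1 t * a1 t)); [assumption | lra]).
  split; nra.
Qed.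

(** With [m = b' / a'] and [q = sqrt (1 - m^2)] the equation says [m' = - a' q^2 / b], so
    [b / q] is a constant [K].  Then [u = asin (- m)] has [cos u = q = b / K] and
    [u' = - m' / q = a' / K]. *)
Lemma elliptic_profile :
  (forall t, I t -> b1 t ^ 2 < a1 t ^ 2) -> (forall t, I t -> 0 < b t) ->
  (forall t, I t ->
     b t * (a2 t * b1 t - a1 t * b2 t) + a1 t * (b1 t ^ 2 - a1 t ^ 2) = 0) ->
  exists A theta, 0 < A /\ forall t, I t -> exists u,
    - (PI / 2) < u < PI / 2 /\ a t = A * (u + theta) /\ b t = A * cos u.
Proof.
  intros Htl Hpos Hode.
  set (m := fun t => b1 t / a1 t).
  assert (Hm : forall t, I t -> -1 < m t < 1) by (intros t Ht; now apply slope_bound, Htl).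
  set (q := fun t => sqrt (1 - m t * m t)).
  assert (Hq : forall t, I t -> 0 < q t /\ q t * q t = 1 - m t * m t).
  { intros t Ht. pose proof (Hm t Ht). split; [apply sqrt_lt_R0 | apply sqrt_sqrt]; nra. }
  assert (Db1 : forall t, I t -> b1 t = m t * a1 t).
  { intros t Ht. destruct (slope_bound t (Htl t Ht)) as [N _]. unfold m. now field. }
  assert (Dm : forall t, I t -> is_derive m t (- (a1 t * (1 - m t * m t)) / b t)).
  { intros t Ht. destruct (slope_bound t (Htl t Ht)) as [N _].
    eapply is_derive_eq; [now apply is_derive_slope|].
    pose proof (Hode t Ht) as E. pose proof (Hpos t Ht). unfold m.
    transitivity (b t * (a1 t * b2 t - a2 t * b1 t) / (b t * a1 t ^ 2)); [field; lra|].
    replace (b t * (a1 t * b2 t - a2 t * b1 t)) with (a1 t * (b1 t ^ 2 - a1 t ^ 2)) by lra.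
    field. lra. }
  destruct (constant_on_interval I (fun t => b t / sqrt (1 - m t * m t)) HI) as [K HK].
  { intros t Ht. destruct (Hq t Ht) as [Q S]. pose proof (Dm t Ht) as D.
    pose proof (Hpos t Ht). destruct (Hb t Ht) as [B _].
    auto_derive.
    - known_derivatives; [nra | change (q t <> 0); lra].
    - derive_known. rewrite (Db1 t Ht). change (sqrt (1 + - (m t * m t))) with (q t).
      rewrite <- S. field. lra. }
  cbv beta in HK.
  assert (HbK : forall t, I t -> b t = K * q t).
  { intros t Ht. rewrite <- (HK t Ht). fold (q t). field. apply Rgt_not_eq. now apply Hq. }
  assert (HKpos : 0 < K).
  { destruct (open_interval_inhabited I HI) as [t Ht].
    pose proof (HbK t Ht). pose proof (Hpos t Ht). destruct (Hq t Ht). nra. }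
  destruct (affine_relation (fun t => asin (- m t)) (fun t => a1 t / K) a K) as [c Hc].
  { intros t Ht. destruct (Hq t Ht) as [Q S]. split.
    - eapply is_derive_eq.
      + apply (is_derive_comp_R asin (fun r => - m r)).
        * apply is_derive_asin. pose proof (Hm t Ht). lra.
        * apply (is_derive_opp m). now apply Dm.
      + replace (1 - - m t * - m t) with (1 - m t * m t) by ring. fold (q t).
        rewrite <- S, (HbK t Ht). unfold opp; simpl. field. lra.
    - eapply is_derive_eq; [exact (proj1 (Ha t Ht))|]. field. lra. }
  exists K, (c / K). split; [exact HKpos|]. intros t Ht. exists (asin (- m t)).
  pose proof (Hm t Ht). split; [apply asin_bound_lt; lra|]. split.
  - rewrite (Hc t Ht). field. lra.
  - rewrite cos_asin by lra. rewrite (HbK t Ht). unfold q, Rsqr. do 2 f_equal. ring.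
Qed.

(** With [m = b' / a'] and [q = sqrt (1 - m^2)] the equation says [m' = - a' m q^2 / a], so
    [a m / q] is a constant [K].  If it vanishes, so does [b' = m a'].  Otherwise
    [u = arcsinh (a / |K|)] has [cosh u = 1 / |m|], whence [u' = a' |m| / |K| = b' / K]
    since [m] and [K] have the same sign.  The sign [e] is that of [K]. *)
Lemma hyperbolic_profile :
  (forall t, I t -> b1 t ^ 2 < a1 t ^ 2) -> (forall t, I t -> 0 < a t) ->
  (forall t, I t ->
     a t * (a1 t * b2 t - a2 t * b1 t) = b1 t * (b1 t ^ 2 - a1 t ^ 2)) ->
  (exists k, forall t, I t -> b t = k) \/
  exists e A theta, e ^ 2 = 1 /\ 0 < A /\ forall t, I t -> exists u,
    0 < u /\ a t = A * sinh u /\ e * b t = A * (u - theta).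
Proof.
  intros Htl Hpos Hode.
  set (m := fun t => b1 t / a1 t).
  assert (Hm : forall t, I t -> -1 < m t < 1) by (intros t Ht; now apply slope_bound, Htl).
  set (q := fun t => sqrt (1 - m t * m t)).
  assert (Hq : forall t, I t -> 0 < q t /\ q t * q t = 1 - m t * m t).
  { intros t Ht. pose proof (Hm t Ht). split; [apply sqrt_lt_R0 | apply sqrt_sqrt]; nra. }
  assert (Db1 : forall t, I t -> b1 t = m t * a1 t).
  { intros t Ht. destruct (slope_bound t (Htl t Ht)) as [N _]. unfold m. now field. }
  assert (Dm : forall t, I t -> is_derive m t (- (a1 t * m t * (1 - m t * m t)) / a t)).
  { intros t Ht. destruct (slope_bound t (Htl t Ht)) as [N _].
    eapply is_derive_eq; [now apply is_derive_slope|].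
    pose proof (Hode t Ht) as E. pose proof (Hpos t Ht). unfold m.
    transitivity (a t * (a1 t * b2 t - a2 t * b1 t) / (a t * a1 t ^ 2)); [field; lra|].
    rewrite E. field. lra. }
  destruct (constant_on_interval I (fun t => a t * m t / sqrt (1 - m t * m t)) HI) as [K HK].
  { intros t Ht. destruct (Hq t Ht) as [Q S]. pose proof (Dm t Ht) as D.
    pose proof (Hpos t Ht). destruct (Ha t Ht) as [A _].
    auto_derive.
    - known_derivatives; [nra | change (q t <> 0); lra].
    - derive_known. change (sqrt (1 + - (m t * m t))) with (q t).
      rewrite <- S. transitivity (a1 t * m t * (1 - m t * m t - q t * q t) / q t);
        [field; lra|]. rewrite S. field. lra. }
  cbv beta in HK.
  assert (HaK : forall t, I t -> a t * m t = K * q t).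
  { intros t Ht. rewrite <- (HK t Ht). fold (q t). field. apply Rgt_not_eq. now apply Hq. }
  destruct (Req_dec K 0) as [K0 | K0].
  { left. apply (constant_on_interval I b HI). intros t Ht.
    eapply is_derive_eq; [exact (proj1 (Hb t Ht))|]. rewrite (Db1 t Ht).
    pose proof (HaK t Ht) as E. pose proof (Hpos t Ht). rewrite K0 in E.
    assert (m t = 0) by nra. nra. }
  right.
  set (A := Rabs K). assert (HA : 0 < A) by now apply Rabs_pos_lt.
  assert (HA2 : A * A = K * K) by (unfold A, Rabs; destruct (Rcase_abs K); ring).
  destruct (affine_relation (fun t => arcsinh (a t / A)) (fun t => b1 t / K) b K) as [c Hc].
  { intros t Ht. destruct (Hq t Ht) as [Q S]. pose proof (Hpos t Ht) as P.
    pose proof (HaK t Ht) as E. split.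
    - eapply is_derive_eq.
      + apply (is_derive_comp_R arcsinh (fun r => a r / A)).
        * apply is_derive_arcsinh.
        * apply (is_derive_ext_R (fun r => 0 * a r + 0 * a r + / A * a r + 0));
            [intros; field; lra|]. apply is_derive_affine; exact (proj1 (Ha t Ht)).
      + assert (Hm0 : m t / K * A <> 0).
        { intros Z. assert (m t = 0).
          { replace (m t) with (m t / K * A * (K / A)) by (field; lra). rewrite Z. ring. }
          nra. }
        assert (Hs : 0 < m t / K * A).
        { assert (m t / K = q t / a t).
          { apply (Rmult_eq_reg_r (K * a t)); [|nra]. field_simplify; [lra|lra|lra]. }
          rewrite H. apply Rmult_lt_0_compat; [|exact HA]. now apply Rdiv_lt_0_compat. }
        (* [cosh u = 1 / |m|]; here [m / K * A] is [|m|]. *)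
        assert (Hr : sqrt ((a t / A) ^ 2 + 1) = / (m t / K * A)).
        { assert (Hi : 0 < / (m t / K * A)) by now apply Rinv_0_lt_compat.
          rewrite <- (sqrt_pow2 (/ (m t / K * A))) by lra. f_equal.
          apply (Rmult_eq_reg_r ((m t / K * A) ^ 2)); [|nra].
          replace ((/ (m t / K * A)) ^ 2 * (m t / K * A) ^ 2) with 1 by (field; repeat split; nra).
          replace (((a t / A) ^ 2 + 1) * (m t / K * A) ^ 2) with
            (((a t * m t) * (a t * m t) + m t * m t * (A * A)) / (K * K)) by (field; lra).
          rewrite E, HA2. replace (K * q t * (K * q t)) with (K * K * (q t * q t)) by ring.
          rewrite S. field. lra. }
        rewrite Hr, Rinv_inv, (Db1 t Ht). field. lra.
    - eapply is_derive_eq; [exact (proj1 (Hb t Ht))|]. now field. }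
  (* [K / A] is the sign of [K]. *)
  exists (K / A), A, (- c / K). repeat split; [| exact HA |].
  - replace ((K / A) ^ 2) with (K * K / (A * A)) by (field; lra). rewrite HA2. field. lra.
  - intros t Ht. exists (arcsinh (a t / A)). pose proof (Hpos t Ht). repeat split.
    + apply arcsinh_pos. now apply Rdiv_lt_0_compat.
    + rewrite sinh_arcsinh. field. lra.
    + rewrite (Hc t Ht).
      apply (Rmult_eq_reg_r A); [|lra].
      replace (A * (arcsinh (a t / A) - - c / K) * A) with
        (A * A * (arcsinh (a t / A) + c / K)) by (field; lra). rewrite HA2. field. lra.
Qed.

(** This is the Euclidean catenary: with [n = sqrt (a'^2 + b'^2)] the equation says that
    [a b' / n] is a constant [K].  If it vanishes, so does [b'].  Otherwise
    [v = arcsinh (a' / b')] has [cosh v = n / |b'| = a / |K|] and [v' = b' / |K|]. *)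
Lemma catenary_profile :
  (forall t, I t -> a1 t ^ 2 + b1 t ^ 2 <> 0) -> (forall t, I t -> 0 < a t) ->
  (forall t, I t ->
     a t * (a1 t * b2 t - a2 t * b1 t) = - (b1 t * (a1 t ^ 2 + b1 t ^ 2))) ->
  (exists k, forall t, I t -> b t = k) \/
  exists A theta, 0 < A /\ forall t, I t -> exists v,
    a t = A * cosh v /\ b t = A * (v - theta).
Proof.
  intros Hreg Hpos Hode.
  set (n := fun t => sqrt (a1 t * a1 t + b1 t * b1 t)).
  assert (Hn : forall t, I t -> 0 < n t /\ n t * n t = a1 t * a1 t + b1 t * b1 t).
  { intros t Ht. pose proof (Hreg t Ht). split; [apply sqrt_lt_R0 | apply sqrt_sqrt]; nra. }
  destruct (constant_on_interval I (fun t => a t * b1 t / sqrt (a1 t * a1 t + b1 t * b1 t)) HI)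
    as [K HK].
  { intros t Ht. destruct (Hn t Ht) as [Q S].
    pose proof (Hpos t Ht). destruct (Ha t Ht) as [A1 A2], (Hb t Ht) as [B1 B2].
    auto_derive.
    - known_derivatives; [nra | fold (n t); lra].
    - derive_known. fold (n t). pose proof (Hode t Ht) as E.
      transitivity (((a1 t * b1 t + a t * b2 t) * (n t * n t)
        - a t * b1 t * (a1 t * a2 t + b1 t * b2 t)) / n t ^ 3); [field; lra|].
      rewrite S. transitivity (a1 t * (a t * (a1 t * b2 t - a2 t * b1 t)
        + b1 t * (a1 t ^ 2 + b1 t ^ 2)) / n t ^ 3); [field; lra|].
      rewrite E. field. lra. }
  cbv beta in HK.
  assert (HaK : forall t, I t -> a t * b1 t = K * n t).
  { intros t Ht. rewrite <- (HK t Ht). fold (n t). field. apply Rgt_not_eq. now apply Hn. }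
  destruct (Req_dec K 0) as [K0 | K0].
  { left. apply (constant_on_interval I b HI). intros t Ht.
    eapply is_derive_eq; [exact (proj1 (Hb t Ht))|].
    pose proof (HaK t Ht) as E. pose proof (Hpos t Ht). rewrite K0 in E. nra. }
  right.
  set (A := Rabs K). assert (HA : 0 < A) by now apply Rabs_pos_lt.
  assert (HA2 : A * A = K * K) by (unfold A, Rabs; destruct (Rcase_abs K); ring).
  assert (Hb1 : forall t, I t -> b1 t <> 0).
  { intros t Ht Z. pose proof (HaK t Ht) as E. rewrite Z in E. destruct (Hn t Ht). nra. }
  assert (Hr : forall t, I t -> sqrt ((a1 t / b1 t) ^ 2 + 1) = a t / A).
  { intros t Ht. destruct (Hn t Ht) as [Q S]. pose proof (Hpos t Ht) as P.
    pose proof (Hb1 t Ht) as B.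
    rewrite <- (sqrt_pow2 (a t / A)) by (left; now apply Rdiv_lt_0_compat). f_equal.
    apply (Rmult_eq_reg_r (b1 t * b1 t * (A * A)));
      [|repeat apply Rmult_integral_contrapositive_currified; lra].
    replace (((a1 t / b1 t) ^ 2 + 1) * (b1 t * b1 t * (A * A))) with
      ((a1 t * a1 t + b1 t * b1 t) * (A * A)) by now field.
    replace ((a t / A) ^ 2 * (b1 t * b1 t * (A * A))) with
      ((a t * b1 t) * (a t * b1 t)) by (field; lra).
    rewrite (HaK t Ht), HA2, <- S. ring. }
  destruct (affine_relation (fun t => arcsinh (a1 t / b1 t)) (fun t => b1 t / A) b A) as [c Hc].
  { intros t Ht. destruct (Hn t Ht) as [Q S]. pose proof (Hpos t Ht) as P.
    pose proof (HaK t Ht) as E. pose proof (Hb1 t Ht) as B. split.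
    - eapply is_derive_eq.
      + apply (is_derive_comp_R arcsinh (fun r => a1 r / b1 r)).
        * apply is_derive_arcsinh.
        * apply is_derive_div; [exact (proj2 (Ha t Ht)) | exact (proj2 (Hb t Ht)) | exact B].
      + rewrite (Hr t Ht).
        transitivity (- (a t * (a1 t * b2 t - a2 t * b1 t)) * A / (a t * a t * (b1 t * b1 t)));
          [field; lra|].
        rewrite (Hode t Ht).
        replace (a t * a t * (b1 t * b1 t)) with ((a t * b1 t) * (a t * b1 t)) by ring.
        rewrite E. replace (K * n t * (K * n t)) with (K * K * (n t * n t)) by ring.
        assert (0 < a1 t * a1 t + b1 t * b1 t) by (rewrite <- S; now apply Rmult_lt_0_compat).
        rewrite <- HA2, S. field. repeat split; lra.
    - eapply is_derive_eq; [exact (proj1 (Hb t Ht))|]. field. lra. }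
  exists A, (- c / A). split; [exact HA|]. intros t Ht. exists (arcsinh (a1 t / b1 t)). split.
  - rewrite cosh_arcsinh, (Hr t Ht). field. lra.
  - rewrite (Hc t Ht). field. lra.
Qed.

(** The slope [b' / a'] divided by [a^2] is a constant [K], negative because [a' b' < 0];
    hence [b - K a^3 / 3] is constant.  The scale is chosen so that [K = - 1 / (2 A^2)]. *)
Lemma parabolic_profile :
  (forall t, I t -> a1 t * b1 t < 0) -> (forall t, I t -> 0 < a t) ->
  (forall t, I t ->
     a t * (a1 t * b2 t - a2 t * b1 t) = 2 * a1 t ^ 2 * b1 t) ->
  exists A c, 0 < A /\ forall t, I t -> b t = - (a t ^ 3 / (6 * A ^ 2)) + c.
Proof.
  intros Htl Hpos Hode.
  assert (N : forall t, I t -> a1 t <> 0) by (intros t Ht; pose proof (Htl t Ht); nra).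
  destruct (constant_on_interval I (fun t => b1 t / a1 t / (a t * a t)) HI) as [K HK].
  { intros t Ht. pose proof (Hpos t Ht). pose proof (N t Ht). pose proof (Hode t Ht) as E.
    pose proof (is_derive_slope t Ht (N t Ht)) as D. destruct (Ha t Ht) as [A _].
    eapply is_derive_eq.
    - apply (is_derive_div (fun r => b1 r / a1 r) (fun r => a r * a r)); [exact D | | nra].
      apply (is_derive_mult a a); [exact A | exact A | intros; apply Rmult_comm].
    - unfold plus, mult; simpl.
      transitivity ((a t * (a1 t * b2 t - a2 t * b1 t) - 2 * a1 t ^ 2 * b1 t)
        / (a t ^ 3 * a1 t ^ 2)); [field; lra|]. rewrite E. field. lra. }
  cbv beta in HK.
  assert (Hb1 : forall t, I t -> b1 t = K * (a t * a t * a1 t)).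
  { intros t Ht. rewrite <- (HK t Ht). field.
    pose proof (N t Ht). pose proof (Hpos t Ht). lra. }
  assert (HKneg : K < 0).
  { destruct (open_interval_inhabited I HI) as [t Ht].
    pose proof (Hb1 t Ht) as E. pose proof (Htl t Ht) as L. rewrite E in L.
    pose proof (N t Ht). pose proof (Hpos t Ht).
    assert (0 < a t * a t * (a1 t * a1 t)) by (apply Rmult_lt_0_compat; nra). nra. }
  destruct (affine_relation (fun t => a t * a t * a t / 3) (fun t => a t * a t * a1 t) b K)
    as [c Hc].
  { intros t Ht. destruct (Ha t Ht) as [A _]. split.
    - auto_derive; [known_derivatives | derive_known; field].
    - rewrite <- Hb1 by exact Ht. exact (proj1 (Hb t Ht)). }
  set (A := sqrt (- / (2 * K))).
  assert (HP : 0 < - / (2 * K)).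
  { rewrite <- Rinv_opp. apply Rinv_0_lt_compat. lra. }
  assert (HA : A ^ 2 = - / (2 * K)) by (unfold A; rewrite pow2_sqrt; lra).
  exists A, c. split; [now apply sqrt_lt_R0|]. intros t Ht. rewrite (Hc t Ht), HA. field. lra.
Qed.
End Profile.

(** * The profile equations *)

(** [F] is undone before [G] moves the standard parametrization into the model. *)
Lemma congruent_intro I J X X0 F G S : isometry F -> isometry G ->
  (forall t s, I t -> J s -> X t s = F (X0 t s)) ->
  (forall t s, I t -> J s -> S (G (X0 t s))) -> congruent_to_part_of I J X S.
Proof.
  intros HF HG HX HS. destruct (isometry_inverse F HF) as (H & HH & HFK).
  exists (fun p => G (H p)). split; [now apply isometry_comp|].
  intros t s Ht Hs. rewrite HX, HFK by assumption. now apply HS.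
Qed.

Lemma planar_of_constant_height I J X X0 F k : isometry F ->
  (forall t s, I t -> J s -> X t s = F (X0 t s)) ->
  (forall t s, I t -> J s -> x3 (X0 t s) = k) -> planar I J X.
Proof.
  intros (M & c & Ma & Ms & Ml & HF) HX Hk.
  exists (M base3), (k + lorentz (M base3) c). split.
  - intros E. pose proof (Ml base3 base3) as L. rewrite E in L. coords. lra.
  - intros t s Ht Hs. rewrite HX, HF by assumption.
    transitivity (lorentz (M base3) (M (X0 t s)) + lorentz (M base3) c).
    + generalize (M base3) (M (X0 t s)). intros. coords. ring.
    + rewrite Ml, <- (Hk t s Ht Hs). coords. ring.
Qed.

Ltac prove_velocity :=
  split; [| split]; unfold x1, x2, x3; cbn [fst snd];
  (auto_derive; [known_derivatives | derive_known; try field; try lra]).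

Ltac prove_jet := split; [| split; [| split; [| split]]]; prove_velocity.

(** In each type the rotation parameter drops out of [minimal_triple_equation] up to the
    square of the nonvanishing profile function, which is the factor cancelled at the end. *)
Section Minimal.
Variables (I J : R -> Prop) (X X0 : R -> R -> L3) (F : L3 -> L3).
Hypothesis HI : is_open_interval I.
Hypothesis HJ : is_open_interval J.
Hypothesis Htl : timelike_surface I J X.
Hypothesis Hmin : minimal_surface I J X.
Hypothesis HF : isometry F.

Lemma elliptic_equation a a1 a2 b b1 b2 :
  (forall t s, I t -> J s -> X t s = F (a t, b t * cos s, b t * sin s)) ->
  (forall t, I t -> is_derive a t (a1 t) /\ is_derive a1 t (a2 t)) ->
  (forall t, I t -> is_derive b t (b1 t) /\ is_derive b1 t (b2 t)) ->
  (forall t, I t -> b t <> 0) ->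
  forall t, I t -> b t * (a2 t * b1 t - a1 t * b2 t) + a1 t * (b1 t ^ 2 - a1 t ^ 2) = 0.
Proof.
  intros HX Ha Hb Hn t Ht. destruct (open_interval_inhabited J HJ) as [s Hs].
  assert (E : b t ^ 2 * (b t * (a2 t * b1 t - a1 t * b2 t) + a1 t * (b1 t ^ 2 - a1 t ^ 2)) = 0).
  { pose proof (minimal_triple_equation I J X F (fun t s => (a t, b t * cos s, b t * sin s))
      (fun t s => (a1 t, b1 t * cos s, b1 t * sin s))
      (fun t s => (0, - (b t * sin s), b t * cos s))
      (fun t s => (a2 t, b2 t * cos s, b2 t * sin s))
      (fun t s => (0, - (b1 t * sin s), b1 t * cos s))
      (fun t s => (0, - (b t * cos s), - (b t * sin s))) HI HJ Htl Hmin HF HX) as H.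
    rewrite <- (H ltac:(intros u v Hu _; destruct (Ha u Hu), (Hb u Hu); prove_jet) t s Ht Hs).
    pose proof (sin2_cos2 s) as T. unfold Rsqr in T.
    assert (T1 : cos s ^ 2 = 1 - sin s ^ 2) by lra.
    coords. ring [T1]. }
  destruct (Rmult_integral _ _ E) as [Z | Z]; [|exact Z].
  exfalso. apply (Hn t Ht). nra.
Qed.

Lemma hyperbolic_equation a a1 a2 b b1 b2 :
  (forall t s, I t -> J s -> X t s = F (a t * cosh s, a t * sinh s, b t)) ->
  (forall t, I t -> is_derive a t (a1 t) /\ is_derive a1 t (a2 t)) ->
  (forall t, I t -> is_derive b t (b1 t) /\ is_derive b1 t (b2 t)) ->
  (forall t, I t -> a t <> 0) ->
  forall t, I t -> a t * (a1 t * b2 t - a2 t * b1 t) = b1 t * (b1 t ^ 2 - a1 t ^ 2).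
Proof.
  intros HX Ha Hb Hn t Ht. destruct (open_interval_inhabited J HJ) as [s Hs].
  assert (E : a t ^ 2 *
    (a t * (a1 t * b2 t - a2 t * b1 t) - b1 t * (b1 t ^ 2 - a1 t ^ 2)) = 0).
  { pose proof (minimal_triple_equation I J X F (fun t s => (a t * cosh s, a t * sinh s, b t))
      (fun t s => (a1 t * cosh s, a1 t * sinh s, b1 t))
      (fun t s => (a t * sinh s, a t * cosh s, 0))
      (fun t s => (a2 t * cosh s, a2 t * sinh s, b2 t))
      (fun t s => (a1 t * sinh s, a1 t * cosh s, 0))
      (fun t s => (a t * cosh s, a t * sinh s, 0)) HI HJ Htl Hmin HF HX) as H.
    rewrite <- (H ltac:(intros u v Hu _; destruct (Ha u Hu), (Hb u Hu); prove_jet) t s Ht Hs).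
    pose proof (cosh_sinh_identity s) as T.
    assert (T1 : cosh s ^ 2 = 1 + sinh s ^ 2) by lra.
    coords. ring [T1]. }
  destruct (Rmult_integral _ _ E) as [Z | Z]; [|lra].
  exfalso. apply (Hn t Ht). nra.
Qed.

Lemma catenary_equation a a1 a2 b b1 b2 :
  (forall t s, I t -> J s -> X t s = F (a s * sinh t, a s * cosh t, b s)) ->
  (forall s, J s -> is_derive a s (a1 s) /\ is_derive a1 s (a2 s)) ->
  (forall s, J s -> is_derive b s (b1 s) /\ is_derive b1 s (b2 s)) ->
  (forall s, J s -> a s <> 0) ->
  forall s, J s -> a s * (a1 s * b2 s - a2 s * b1 s) = - (b1 s * (a1 s ^ 2 + b1 s ^ 2)).
Proof.
  intros HX Ha Hb Hn s Hs. destruct (open_interval_inhabited I HI) as [t Ht].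
  assert (E : a s ^ 2 *
    (a s * (a1 s * b2 s - a2 s * b1 s) + b1 s * (a1 s ^ 2 + b1 s ^ 2)) = 0).
  { pose proof (minimal_triple_equation I J X F (fun t s => (a s * sinh t, a s * cosh t, b s))
      (fun t s => (a s * cosh t, a s * sinh t, 0))
      (fun t s => (a1 s * sinh t, a1 s * cosh t, b1 s))
      (fun t s => (a s * sinh t, a s * cosh t, 0))
      (fun t s => (a1 s * cosh t, a1 s * sinh t, 0))
      (fun t s => (a2 s * sinh t, a2 s * cosh t, b2 s)) HI HJ Htl Hmin HF HX) as H.
    apply Ropp_eq_reg. rewrite Ropp_0.
    rewrite <- (H ltac:(intros u v _ Hv; destruct (Ha v Hv), (Hb v Hv); prove_jet) t s Ht Hs).
    pose proof (cosh_sinh_identity t) as T.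
    assert (T1 : cosh t ^ 2 = 1 + sinh t ^ 2) by lra.
    coords. ring [T1]. }
  destruct (Rmult_integral _ _ E) as [Z | Z]; [|lra].
  exfalso. apply (Hn s Hs). nra.
Qed.

Lemma parabolic_equation a a1 a2 b b1 b2 :
  (forall t s, I t -> J s -> X t s = F ((a t - b t) / sqrt 2 + a t * s ^ 2 / (2 * sqrt 2),
       (a t + b t) / sqrt 2 - a t * s ^ 2 / (2 * sqrt 2), s * a t)) ->
  (forall t, I t -> is_derive a t (a1 t) /\ is_derive a1 t (a2 t)) ->
  (forall t, I t -> is_derive b t (b1 t) /\ is_derive b1 t (b2 t)) ->
  (forall t, I t -> a t <> 0) ->
  forall t, I t -> a t * (a1 t * b2 t - a2 t * b1 t) = 2 * a1 t ^ 2 * b1 t.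
Proof.
  intros HX Ha Hb Hn t Ht. destruct (open_interval_inhabited J HJ) as [s Hs].
  assert (Hw : sqrt 2 <> 0) by (apply Rgt_not_eq, sqrt_lt_R0; lra).
  assert (E : a t ^ 2 *
    (a t * (a1 t * b2 t - a2 t * b1 t) - 2 * a1 t ^ 2 * b1 t) = 0).
  { pose proof (minimal_triple_equation I J X F
      (fun t s => ((a t - b t) / sqrt 2 + a t * s ^ 2 / (2 * sqrt 2),
         (a t + b t) / sqrt 2 - a t * s ^ 2 / (2 * sqrt 2), s * a t))
      (fun t s => ((a1 t - b1 t) / sqrt 2 + a1 t * s ^ 2 / (2 * sqrt 2),
         (a1 t + b1 t) / sqrt 2 - a1 t * s ^ 2 / (2 * sqrt 2), s * a1 t))
      (fun t s => (a t * s / sqrt 2, - (a t * s / sqrt 2), a t))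
      (fun t s => ((a2 t - b2 t) / sqrt 2 + a2 t * s ^ 2 / (2 * sqrt 2),
         (a2 t + b2 t) / sqrt 2 - a2 t * s ^ 2 / (2 * sqrt 2), s * a2 t))
      (fun t s => (a1 t * s / sqrt 2, - (a1 t * s / sqrt 2), a1 t))
      (fun t s => (a t / sqrt 2, - (a t / sqrt 2), 0)) HI HJ Htl Hmin HF HX) as H.
    apply Ropp_eq_reg. rewrite Ropp_0.
    rewrite <- (H ltac:(intros u v Hu _; destruct (Ha u Hu), (Hb u Hu); prove_jet) t s Ht Hs).
    (* Along the null directions only [k * k = / 2] matters. *)
    set (k := / sqrt 2).
    assert (K : k * k = / 2).
    { unfold k. rewrite <- Rinv_mult. f_equal. apply sqrt_sqrt. lra. }
    unfold Rdiv. rewrite !Rinv_mult. fold k.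
    coords.
    match goal with |- _ = ?A * ?L - 2 * ?B * ?N + ?C * ?M =>
      replace A with (2 * (k * k) * (a t * (a2 t * b1 t - a1 t * b2 t))) by field;
      replace C with (2 * (k * k) * (a t ^ 2 * a1 t)) by field;
      replace L with (a t ^ 2) by ring;
      replace N with (a t * a1 t * s * (1 - 2 * (k * k))) by field;
      replace M with (4 * (k * k) * (a1 t * (b1 t - a1 t * s ^ 2 * / 2))
        + s ^ 2 * a1 t ^ 2) by field end.
    rewrite K. field. }
  destruct (Rmult_integral _ _ E) as [Z | Z]; [|lra].
  exfalso. apply (Hn t Ht). nra.
Qed.
End Minimal.

(** * The four types of revolution *)

Lemma flip_derivatives (I : R -> Prop) (f f1 f2 : R -> R) (e : R) :
  (forall t, I t -> is_derive f t (f1 t) /\ is_derive f1 t (f2 t)) ->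
  forall t, I t -> is_derive (fun r => e * f r) t (e * f1 t) /\
    is_derive (fun r => e * f1 r) t (e * f2 t).
Proof.
  intros H t Ht. destruct (H t Ht). split; now apply is_derive_scal.
Qed.

Section Classification.
Variables (I J : R -> Prop) (X : R -> R -> L3) (F : L3 -> L3).
Hypothesis HI : is_open_interval I.
Hypothesis HJ : is_open_interval J.
Hypothesis Htl : timelike_surface I J X.
Hypothesis Han : analytic_surface I J X.
Hypothesis Hmin : minimal_surface I J X.
Hypothesis HF : isometry F.

(** All three coordinates are multiplied by the sign [e] of [b], which reduces to [b > 0]. *)
Lemma elliptic_case a b :
  (forall t s, I t -> J s -> X t s = F (a t, b t * cos s, b t * sin s)) ->
  timelike_curve I (fun t => (a t, b t, 0)) -> (forall t, I t -> b t <> 0) ->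
  exists A theta, 0 < A /\ congruent_to_part_of I J X (elliptic_catenoid A theta).
Proof.
  intros HX Hc Hn. destruct (open_interval_inhabited J HJ) as [s0 Hs0].
  pose proof (analytic_profile_C2 I J X _ F Han HF HI HJ HX) as Hreg.
  assert (Ca : C2_on I a).
  { apply (C2_on_ext I _ a HI) with (2 := proj1 (Hreg 0 1 0 0) s0 Hs0).
    intros t _. coords. ring. }
  assert (Cb : C2_on I b).
  { apply (C2_on_ext I _ b HI) with (2 := proj1 (Hreg 0 0 (cos s0) (sin s0)) s0 Hs0).
    intros t _. pose proof (sin2_cos2 s0) as T. unfold Rsqr in T. coords.
    transitivity (b t * (sin s0 * sin s0 + cos s0 * cos s0)); [ring | rewrite T; ring]. }
  destruct Ca as (a1 & a2 & Ha), Cb as (b1 & b2 & Hb).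
  destruct (constant_sign I b b1 HI (fun t Ht => proj1 (Hb t Ht)) Hn) as (e & He & Hpos).
  pose proof (elliptic_equation I J X F HI HJ Htl Hmin HF a a1 a2 b b1 b2 HX Ha Hb Hn) as Hode.
  assert (Hslope : forall t, I t -> b1 t ^ 2 < a1 t ^ 2).
  { intros t Ht. pose proof (Hc t Ht) as L. destruct (Ha t Ht), (Hb t Ht).
    rewrite (velocity_unique _ t (a1 t, b1 t, 0)) in L by prove_velocity.
    coords. lra. }
  destruct (elliptic_profile I (fun t => e * a t) (fun t => e * a1 t) (fun t => e * a2 t)
    (fun t => e * b t) (fun t => e * b1 t) (fun t => e * b2 t) HI
    (flip_derivatives I a a1 a2 e Ha) (flip_derivatives I b b1 b2 e Hb))
    as (A & theta & HA & Hu); [ | exact Hpos | | ].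
  - intros t Ht. rewrite !Rpow_mult_distr, He. specialize (Hslope t Ht). lra.
  - intros t Ht. transitivity (e ^ 2 * e *
      (b t * (a2 t * b1 t - a1 t * b2 t) + a1 t * (b1 t ^ 2 - a1 t ^ 2))); [ring|].
    rewrite (Hode t Ht). ring.
  - exists A, theta. split; [exact HA|].
    apply (congruent_intro I J X _ F _ _ HF (isometry_flip e e (0, 0, 0) He He) HX).
    intros t s Ht Hs. destruct (Hu t Ht) as (u & Hu1 & Hu2 & Hu3).
    exists u, s. split; [exact Hu1|]. apply L3_eq; coords.
    + rewrite Hu2. ring.
    + rewrite <- !Rmult_assoc, Hu3. ring.
    + rewrite <- !Rmult_assoc, Hu3. ring.
Qed.

(** The sign [e] of [a] acts on the first two coordinates, and the sign [f] of the first
    integral on the axis. *)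
Lemma hyperbolic_case a b :
  (forall t s, I t -> J s -> X t s = F (a t * cosh s, a t * sinh s, b t)) ->
  timelike_curve I (fun t => (a t, 0, b t)) -> (forall t, I t -> a t <> 0) ->
  ~ planar I J X ->
  exists A theta, 0 < A /\ congruent_to_part_of I J X (hyperbolic_catenoid A theta).
Proof.
  intros HX Hc Hn Hnp. destruct (open_interval_inhabited J HJ) as [s0 Hs0].
  pose proof (analytic_profile_C2 I J X _ F Han HF HI HJ HX) as Hreg.
  assert (Ca : C2_on I a).
  { apply (C2_on_ext I _ a HI) with (2 := proj1 (Hreg 0 (cosh s0) (- sinh s0) 0) s0 Hs0).
    intros t _. pose proof (cosh_sinh_identity s0) as T. coords.
    transitivity (a t * (cosh s0 * cosh s0 - sinh s0 * sinh s0)); [ring | rewrite T; ring]. }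
  assert (Cb : C2_on I b).
  { apply (C2_on_ext I _ b HI) with (2 := proj1 (Hreg 0 0 0 1) s0 Hs0).
    intros t _. coords. ring. }
  destruct Ca as (a1 & a2 & Ha), Cb as (b1 & b2 & Hb).
  destruct (constant_sign I a a1 HI (fun t Ht => proj1 (Ha t Ht)) Hn) as (e & He & Hpos).
  pose proof (hyperbolic_equation I J X F HI HJ Htl Hmin HF a a1 a2 b b1 b2 HX Ha Hb Hn) as Hode.
  assert (Hslope : forall t, I t -> b1 t ^ 2 < a1 t ^ 2).
  { intros t Ht. pose proof (Hc t Ht) as L. destruct (Ha t Ht), (Hb t Ht).
    rewrite (velocity_unique _ t (a1 t, 0, b1 t)) in L by prove_velocity.
    coords. lra. }
  destruct (hyperbolic_profile I (fun t => e * a t) (fun t => e * a1 t) (fun t => e * a2 t)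
    b b1 b2 HI (flip_derivatives I a a1 a2 e Ha) Hb)
    as [[k Hk] | (f & A & theta & Hf & HA & Hu)]; [ | exact Hpos | | | ].
  - intros t Ht. rewrite Rpow_mult_distr, He. specialize (Hslope t Ht). lra.
  - intros t Ht. rewrite Rpow_mult_distr.
    transitivity (e ^ 2 * (a t * (a1 t * b2 t - a2 t * b1 t))); [ring|].
    rewrite (Hode t Ht), He. ring.
  - exfalso. apply Hnp. apply (planar_of_constant_height I J X _ F k HF HX).
    intros t s Ht _. exact (Hk t Ht).
  - exists A, theta. split; [exact HA|].
    apply (congruent_intro I J X _ F _ _ HF (isometry_flip e f (0, 0, 0) He Hf) HX).
    intros t s Ht Hs. destruct (Hu t Ht) as (u & Hu1 & Hu2 & Hu3).
    exists u, s. split; [exact Hu1|]. apply L3_eq; coords.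
    + rewrite <- !Rmult_assoc, Hu2. ring.
    + rewrite <- !Rmult_assoc, Hu2. ring.
    + rewrite Hu3. ring.
Qed.

Lemma catenary_case a b :
  (forall t s, I t -> J s -> X t s = F (a s * sinh t, a s * cosh t, b s)) ->
  (forall s, J s -> a s <> 0) -> (forall s, J s -> Derive a s ^ 2 + Derive b s ^ 2 <> 0) ->
  ~ planar I J X ->
  exists A theta, 0 < A /\ congruent_to_part_of I J X (spacelike_profile_surface A theta).
Proof.
  intros HX Hn Hc Hnp. destruct (open_interval_inhabited I HI) as [t0 Ht0].
  pose proof (analytic_profile_C2 I J X _ F Han HF HI HJ HX) as Hreg.
  assert (Ca : C2_on J a).
  { apply (C2_on_ext J _ a HJ) with (2 := proj2 (Hreg 0 (- sinh t0) (cosh t0) 0) t0 Ht0).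
    intros t _. pose proof (cosh_sinh_identity t0) as T. coords.
    transitivity (a t * (cosh t0 * cosh t0 - sinh t0 * sinh t0)); [ring | rewrite T; ring]. }
  assert (Cb : C2_on J b).
  { apply (C2_on_ext J _ b HJ) with (2 := proj2 (Hreg 0 0 0 1) t0 Ht0).
    intros t _. coords. ring. }
  destruct Ca as (a1 & a2 & Ha), Cb as (b1 & b2 & Hb).
  destruct (constant_sign J a a1 HJ (fun t Ht => proj1 (Ha t Ht)) Hn) as (e & He & Hpos).
  pose proof (catenary_equation I J X F HI HJ Htl Hmin HF a a1 a2 b b1 b2 HX Ha Hb Hn) as Hode.
  destruct (catenary_profile J (fun t => e * a t) (fun t => e * a1 t) (fun t => e * a2 t)
    b b1 b2 HJ (flip_derivatives J a a1 a2 e Ha) Hb)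
    as [[k Hk] | (A & theta & HA & Hu)]; [ | exact Hpos | | | ].
  - intros s Hs. rewrite Rpow_mult_distr, He, Rmult_1_l.
    rewrite <- (is_derive_unique _ _ _ (proj1 (Ha s Hs))),
      <- (is_derive_unique _ _ _ (proj1 (Hb s Hs))). now apply Hc.
  - intros s Hs. rewrite Rpow_mult_distr.
    transitivity (e ^ 2 * (a s * (a1 s * b2 s - a2 s * b1 s))); [ring|].
    rewrite (Hode s Hs), He. ring.
  - exfalso. apply Hnp. apply (planar_of_constant_height I J X _ F k HF HX).
    intros t s _ Hs. exact (Hk s Hs).
  - exists A, theta. split; [exact HA|].
    apply (congruent_intro I J X _ F _ _ HF (isometry_flip e 1 (0, 0, 0) He ltac:(ring)) HX).
    intros t s Ht Hs. destruct (Hu s Hs) as (v & Hv1 & Hv2).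
    exists t, v. apply L3_eq; coords.
    + rewrite <- !Rmult_assoc, Hv1. ring.
    + rewrite <- !Rmult_assoc, Hv1. ring.
    + rewrite Hv2. ring.
Qed.

Lemma parabolic_case a b :
  (forall t s, I t -> J s -> X t s = F ((a t - b t) / sqrt 2 + a t * s ^ 2 / (2 * sqrt 2),
       (a t + b t) / sqrt 2 - a t * s ^ 2 / (2 * sqrt 2), s * a t)) ->
  (forall t, I t -> Derive a t * Derive b t < 0) -> (forall t, I t -> a t <> 0) ->
  exists A B, 0 < A /\ congruent_to_part_of I J X (parabolic_catenoid A B).
Proof.
  intros HX Hc Hn. destruct (open_interval_inhabited J HJ) as [s0 Hs0].
  assert (Hw : sqrt 2 <> 0) by (apply Rgt_not_eq, sqrt_lt_R0; lra).
  assert (W : sqrt 2 * sqrt 2 = 2) by (apply sqrt_sqrt; lra).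
  pose proof (analytic_profile_C2 I J X _ F Han HF HI HJ HX) as Hreg.
  assert (Ca : C2_on I a).
  { apply (C2_on_ext I _ a HI) with (2 := proj1 (Hreg 0 (sqrt 2 / 2) (sqrt 2 / 2) 0) s0 Hs0).
    intros t _. coords. field. exact Hw. }
  assert (Cb : C2_on I b).
  { apply (C2_on_ext I _ b HI)
      with (2 := proj1 (Hreg 0 (- sqrt 2 / 2) (sqrt 2 / 2) (s0 / 2)) s0 Hs0).
    intros t _. coords. field. exact Hw. }
  destruct Ca as (a1 & a2 & Ha), Cb as (b1 & b2 & Hb).
  destruct (constant_sign I a a1 HI (fun t Ht => proj1 (Ha t Ht)) Hn) as (e & He & Hpos).
  pose proof (parabolic_equation I J X F HI HJ Htl Hmin HF a a1 a2 b b1 b2 HX Ha Hb Hn) as Hode.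
  destruct (parabolic_profile I (fun t => e * a t) (fun t => e * a1 t) (fun t => e * a2 t)
    (fun t => e * b t) (fun t => e * b1 t) (fun t => e * b2 t) HI
    (flip_derivatives I a a1 a2 e Ha) (flip_derivatives I b b1 b2 e Hb))
    as (A & c & HA & Hu); [ | exact Hpos | | ].
  - intros t Ht. pose proof (Hc t Ht) as L.
    rewrite (is_derive_unique _ _ _ (proj1 (Ha t Ht))),
      (is_derive_unique _ _ _ (proj1 (Hb t Ht))) in L.
    replace (e * a1 t * (e * b1 t)) with (e ^ 2 * (a1 t * b1 t)) by ring. rewrite He. lra.
  - intros t Ht.
    transitivity (e ^ 2 * e * (a t * (a1 t * b2 t - a2 t * b1 t))); [ring|].
    rewrite (Hode t Ht). ring.
  (* The additive constant [c] is a translation along the null axis, so [B = 0] suffices;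
     the model has [q = - A t], which forces the parameters below. *)
  - exists A, 0. split; [exact HA|].
    apply (congruent_intro I J X _ F _ _ HF (isometry_flip e e (scal3 (- c) null1) He He) HX).
    intros t s Ht Hs. exists (- (e * a t) / A), (- s). split.
    + pose proof (Hpos t Ht). rewrite Ropp_0.
      assert (0 < e * a t / A) by now apply Rdiv_lt_0_compat.
      replace (- (e * a t) / A) with (- (e * a t / A)) by (field; lra). lra.
    + pose proof (Hu t Ht) as Eb.
      assert (R2 : / sqrt 2 = sqrt 2 / 2) by (rewrite <- W at 3; field; exact Hw).
      unfold null1, null2, unit3. unfold Rdiv. rewrite !Rinv_mult, R2.
      apply L3_eq; coords.
      * transitivity (sqrt 2 / 2 * (e * a t - e * b t + e * a t * s ^ 2 / 2 + c)); [field|].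
        rewrite Eb. field. lra.
      * transitivity (sqrt 2 / 2 * (e * a t + e * b t - e * a t * s ^ 2 / 2 - c)); [field|].
        rewrite Eb. field. lra.
      * field. lra.
Qed.
End Classification.

(* Non-planarity is needed: constant [b] in [rev_b] or [rev_c] gives a piece of the
   timelike plane x3 = b, which is minimal but not among the four models. *)
Theorem theorem1p2 (I J : R -> Prop) (X : R -> R -> L3)
    (hI : is_open_interval I) (hJ : is_open_interval J)
    (hrev : timelike_surface_of_revolution I J X)
    (hanalytic : analytic_surface I J X)
    (hminimal : minimal_surface I J X)
    (hnonplanar : ~ planar I J X) :
  (exists A theta : R, 0 < A /\ congruent_to_part_of I J X (elliptic_catenoid A theta)) \/
  (exists A theta : R, 0 < A /\ congruent_to_part_of I J X (hyperbolic_catenoid A theta)) \/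
  (exists A theta : R, 0 < A /\ congruent_to_part_of I J X (spacelike_profile_surface A theta)) \/
  (exists A B : R, 0 < A /\ congruent_to_part_of I J X (parabolic_catenoid A B)).
Proof.
  destruct hrev as (htl & F & X0 & hF & hparam & hX).
  destruct hparam as [a b hc hn | a b hc hn | a b hn hc | a b hc hn].
  - left. now apply (elliptic_case I J X F) with a b.
  - right; left. now apply (hyperbolic_case I J X F) with a b.
  - right; right; left. now apply (catenary_case I J X F) with a b.
  - right; right; right. now apply (parabolic_case I J X F) with a b.
Qed.
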